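(* Let $G$ be a topological group containing a subspace homeomorphic to $W$. Then $G$ is not homeomorphic to a subspace of any countable product $\prod_{n=1}^\infty X_n$ (with the product topology) of topological spaces $X_n$ each of which has property $(\mathcal M)$.
   Context: $K=\{x_0\}\cup\{x_{n,m}:n,m\in\mathbb N\}\subset\mathbb R^2$ where $x_0=(0,0)$ and $x_{n,m}=(\tfrac1n,\tfrac1{nm})$, with the subspace topology. Let $S_0=\{0\}\cup\{\tfrac1n:n\in\mathbb N\}$ and $V=(\mathbb N\times S_0)/(\mathbb N\times\{0\})$ (quotient topology, $\mathbb N$ discrete); write $y_0$ for the image of $\mathbb N\times\{0\}$ and $y_{n,m}$ for the image of $(n,\tfrac1m)$. In $K\times V$ (product topology) consider the points $z_0=(x_0,y_0)$, $z_{n,m}=(x_{n,m},y_0)$, $z_{n,m,p,q}=(x_{n,m},y_{p,n+q})$ for $n,m,p,q\in\mathbb N$. Let $W_0=\{z_0\}\cup\{z_{n,m}:n,m\in\mathbb N\}$ and $W_p=W_{p-1}\cup\{z_{n,m,p,q}:n,m,q\in\mathbb N\}$ for $p\ge1$, each with the subspace topology from $K\times V$. The test space $W$ is the set $\bigcup_{p\ge0}W_p$ with the direct limit topology: $U\subset W$ is open iff $U\cap W_p$ is open in $W_p$ for every $p$. A space $X$ has property $(\mathcal M)$ if for every continuous map $f:Y\to X$ from a metrizable space $Y$ and every $y\in Y$ there is a neighborhood $U$ of $y$ in $Y$ such that the subspace $f(U)\subset X$ has a countable neighborhood base at $f(y)$. *)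

(* Defs.v *)
From Stdlib Require Import Reals.
Open Scope R_scope.

Definition is_topology {X : Type} (opn : (X -> Prop) -> Prop) : Prop :=
  opn (fun _ => True) /\
  (forall U V, opn U -> opn V -> opn (fun x => U x /\ V x)) /\
  (forall F : (X -> Prop) -> Prop, (forall U, F U -> opn U) ->
     opn (fun x => exists U, F U /\ U x)).

Definition continuous {X Y : Type} (oX : (X -> Prop) -> Prop)
  (oY : (Y -> Prop) -> Prop) (f : X -> Y) : Prop :=
  forall V, oY V -> oX (fun x => V (f x)).

Definition homeomorphic (X : Type) (oX : (X -> Prop) -> Prop)
  (Y : Type) (oY : (Y -> Prop) -> Prop) : Prop :=
  exists (f : X -> Y) (g : Y -> X),
    (forall x, g (f x) = x) /\ (forall y, f (g y) = y) /\
    continuous oX oY f /\ continuous oY oX g.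

Definition subspace_open {X : Type} (oX : (X -> Prop) -> Prop) (A : X -> Prop)
  : ({x : X | A x} -> Prop) -> Prop :=
  fun V => exists U, oX U /\ forall s : {x : X | A x}, V s <-> U (proj1_sig s).

(* topology induced on A by a map f : A -> X (for injective f this is the
   subspace topology of the image, transported along f) *)
Definition induced_open {A X : Type} (oX : (X -> Prop) -> Prop) (f : A -> X)
  : (A -> Prop) -> Prop :=
  fun V => exists U, oX U /\ forall a, V a <-> U (f a).

Definition quotient_open {A B : Type} (oA : (A -> Prop) -> Prop) (q : A -> B)
  : (B -> Prop) -> Prop :=
  fun U => oA (fun a => U (q a)).

Definition discrete_open (X : Type) : (X -> Prop) -> Prop := fun _ => True.

Definition prod2_open {X Y : Type} (oX : (X -> Prop) -> Prop)
  (oY : (Y -> Prop) -> Prop) : (X * Y -> Prop) -> Prop :=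
  fun U => forall p, U p -> exists O1 O2, oX O1 /\ oY O2 /\ O1 (fst p) /\ O2 (snd p) /\
     forall x y, O1 x -> O2 y -> U (x, y).

Definition prod_open (X : nat -> Type) (oX : forall n, (X n -> Prop) -> Prop)
  : ((forall n, X n) -> Prop) -> Prop :=
  fun U => forall x, U x -> exists (N : nat) (O : forall n, X n -> Prop),
     (forall n, oX n (O n)) /\ (forall n, (N <= n)%nat -> forall t, O n t) /\
     (forall n, O n (x n)) /\
     (forall y, (forall n, O n (y n)) -> U y).

Definition nbhd {X : Type} (oX : (X -> Prop) -> Prop) (N : X -> Prop) (x : X) : Prop :=
  exists O, oX O /\ O x /\ forall z, O z -> N z.

Definition countable_base_at {X : Type} (oX : (X -> Prop) -> Prop) (x : X) : Prop :=
  exists B : nat -> X -> Prop, (forall n, nbhd oX (B n) x) /\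
    forall O, oX O -> O x -> exists n, forall z, B n z -> O z.

Definition is_metric {Y : Type} (d : Y -> Y -> R) : Prop :=
  (forall x y, 0 <= d x y) /\ (forall x y, d x y = 0 <-> x = y) /\
  (forall x y, d x y = d y x) /\ (forall x y z, d x z <= d x y + d y z).

Definition metric_open {Y : Type} (d : Y -> Y -> R) : (Y -> Prop) -> Prop :=
  fun U => forall y, U y -> exists eps, 0 < eps /\ forall z, d y z < eps -> U z.

Definition metrizable (Y : Type) (oY : (Y -> Prop) -> Prop) : Prop :=
  exists d : Y -> Y -> R, is_metric d /\ forall U, oY U <-> metric_open d U.

Definition image {Y X : Type} (f : Y -> X) (U : Y -> Prop) : X -> Prop :=
  fun x => exists y, U y /\ f y = x.

Definition propM (X : Type) (oX : (X -> Prop) -> Prop) : Prop :=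
  forall (Y : Type) (oY : (Y -> Prop) -> Prop), metrizable Y oY ->
  forall f : Y -> X, continuous oY oX f ->
  forall y : Y, exists U : Y -> Prop, nbhd oY U y /\
    exists H : image f U (f y),
      countable_base_at (subspace_open oX (image f U)) (exist _ (f y) H).

Definition is_topological_group (G : Type) (oG : (G -> Prop) -> Prop)
  (mul : G -> G -> G) (inv : G -> G) (e : G) : Prop :=
  is_topology oG /\
  (forall x y z, mul x (mul y z) = mul (mul x y) z) /\
  (forall x, mul e x = x) /\ (forall x, mul (inv x) x = e) /\
  continuous (prod2_open oG oG) oG (fun p => mul (fst p) (snd p)) /\
  continuous oG oG inv.

(* Natural-number indices are shifted: index k : nat stands for k+1 in N = {1,2,...}. *)
Definition R_open : (R -> Prop) -> Prop := metric_open (fun x y => Rabs (x - y)).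
Definition R2_open : (R * R -> Prop) -> Prop := prod2_open R_open R_open.

(* K : None = x_0, Some (n,m) = x_{n+1,m+1} *)
Definition Kpt := option (nat * nat).
Definition kval (k : Kpt) : R * R :=
  match k with
  | None => (0, 0)
  | Some (n, m) => (/ INR (S n), / (INR (S n) * INR (S m)))
  end.
Definition K_open : (Kpt -> Prop) -> Prop := induced_open R2_open kval.

Definition S0pt := option nat.
Definition s0val (s : S0pt) : R :=
  match s with None => 0 | Some m => / INR (S m) end.
Definition S0_open : (S0pt -> Prop) -> Prop := induced_open R_open s0val.

(* V = (N x S_0)/(N x {0}) : None = y_0, Some (n,m) = y_{n+1,m+1} *)
Definition Vpt := option (nat * nat).
Definition qV (p : nat * S0pt) : Vpt :=
  match p with (_, None) => None | (n, Some m) => Some (n, m) end.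
Definition V_open : (Vpt -> Prop) -> Prop :=
  quotient_open (prod2_open (discrete_open nat) S0_open) qV.

Definition KV_open : (Kpt * Vpt -> Prop) -> Prop := prod2_open K_open V_open.

(* points of W: z0, z2 n m = z_{n+1,m+1}, z4 n m p q = z_{n+1,m+1,p+1,q+1} *)
Inductive Wpt : Type :=
  | z0 : Wpt
  | z2 : nat -> nat -> Wpt
  | z4 : nat -> nat -> nat -> nat -> Wpt.

(* the (injective) map W -> K x V;  z_{n,m,p,q} = (x_{n,m}, y_{p,n+q}) *)
Definition wval (z : Wpt) : Kpt * Vpt :=
  match z with
  | z0 => (None, None)
  | z2 n m => (Some (n, m), None)
  | z4 n m p q => (Some (n, m), Some (p, (n + q + 1)%nat))
  end.

(* membership in W_p (p = 0,1,2,...): z_{n,m,p',q'} in W_p iff p' <= p *)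
Definition inWp (p : nat) (z : Wpt) : Prop :=
  match z with
  | z4 _ _ p' _ => (p' < p)%nat
  | _ => True
  end.

(* direct limit topology: U open iff U /\ W_p is open in W_p (subspace of K x V) *)
Definition W_open : (Wpt -> Prop) -> Prop :=
  fun U => forall p : nat, exists O, KV_open O /\
     forall z, inWp p z -> (U z <-> O (wval z)).

(* Main.v *)
(** Suppose [G] embeds in the product, with coordinates [pr j : G -> X j].  For
    fixed [p], the points [s n m p q := z_{n,m}^-1 z_{n,m,p,q}] tend to the
    identity as [n] grows (uniformly in [m, q]), and also as [q] grows with [n, m]
    fixed.  The first convergence makes them the continuous image of a metric
    space with one non-isolated point, so property (M) provides, for each [j] and
    [p], a threshold [N j p] beyond which their images in [X j] have a countable
    base at the image of the identity.  Diagonalizing over these bases with the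
    second convergence yields [q p n m] such that, for [n >= N j p], the sequence
    [s n m p (q p n m)] tends to the identity in the [j]-th coordinate as [m]
    grows.  On the other hand, the set of the [z_{n,m,p,q p n m}] with
    [n <= N p], where [N p >= p] and [N p >= N j p] for all [j <= p], is closed
    in [W] and misses [z_0], because its part in each [W_p] involves boundedly
    many [n].  Since [z_{n,m} s n m p q = z_{n,m,p,q}], continuity of the
    multiplication at [(z_0, 1)] contradicts this for [p] large and [n = N p]. *)
Require Import Defs.
From Stdlib Require Import Reals.
From Stdlib Require Import Lra Lia ClassicalEpsilon IndefiniteDescription.

(** * Finite uniformity of thresholds *)

Lemma uniform_threshold (P : nat -> nat -> Prop) :
  (forall i, exists a, forall b, (a <= b)%nat -> P i b) ->
  forall n, exists a, forall i b, (i <= n)%nat -> (a <= b)%nat -> P i b.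
Proof.
  intros HP n; induction n as [|n [a IH]].
  - destruct (HP 0%nat) as [a Ha]; exists a; intros i b Hi Hb.
    replace i with 0%nat by lia; auto.
  - destruct (HP (S n)) as [a' Ha']; exists (a + a')%nat; intros i b Hi Hb.
    destruct (Nat.eq_dec i (S n)) as [-> | Hne].
    + apply Ha'; lia.
    + apply IH; lia.
Qed.

Lemma finite_upper_bound (f : nat -> nat) (n : nat) :
  exists b, forall i, (i <= n)%nat -> (f i <= b)%nat.
Proof.
  destruct (uniform_threshold (fun i b => (f i <= b)%nat)) with (n := n) as [b Hb].
  - intro i; exists (f i); auto.
  - exists b; intros i Hi; apply Hb; lia.
Qed.

(** * The sequence 1/(n+1) and topologies induced from the line and the plane *)

Lemma invS_pos (n : nat) : 0 < / INR (S n).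
Proof. apply Rinv_0_lt_compat, lt_0_INR; lia. Qed.

Lemma invS_anti (a b : nat) : (a <= b)%nat -> / INR (S b) <= / INR (S a).
Proof.
  intro H; apply Rinv_le_contravar; [apply lt_0_INR; lia | apply le_INR; lia].
Qed.

Lemma invS_small (eps : R) : 0 < eps ->
  exists n0, forall n, (n0 <= n)%nat -> / INR (S n) < eps.
Proof.
  intro Heps; destruct (archimed_cor1 eps Heps) as [n0 [Hn0 Hpos]].
  exists n0; intros n Hn; apply Rle_lt_trans with (/ INR n0); [|exact Hn0].
  apply Rinv_le_contravar; [apply lt_0_INR; lia | apply le_INR; lia].
Qed.

Lemma invS_step (n : nat) : / INR (S (S n)) < / INR (S n).
Proof.
  apply Rinv_lt_contravar; [|apply lt_INR; lia].
  apply Rmult_lt_0_compat; apply lt_0_INR; lia.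
Qed.

Lemma invS_isolated (n : nat) : exists eps, 0 < eps /\
  forall k, Rabs (/ INR (S n) - / INR (S k)) < eps -> k = n.
Proof.
  assert (Hup : forall k, (n < k)%nat ->
    / INR (S n) - / INR (S (S n)) <= Rabs (/ INR (S n) - / INR (S k))).
  { intros k Hk; pose proof (invS_anti (S n) k Hk).
    eapply Rle_trans; [|apply Rle_abs]; lra. }
  (* The first term has no predecessor, so any positive radius serves there; otherwise the gap to
     the preceding term does. *)
  assert (Hdown : exists eps, 0 < eps /\ forall k, (k < n)%nat ->
    eps <= Rabs (/ INR (S n) - / INR (S k))).
  { destruct n as [|n].
    - exists 1; split; [lra | intros k Hk; lia].
    - exists (/ INR (S n) - / INR (S (S n))); split.
      + pose proof (invS_step n); lra.
      + intros k Hk; pose proof (invS_anti k n ltac:(lia)).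
        rewrite Rabs_minus_sym; eapply Rle_trans; [|apply Rle_abs]; lra. }
  destruct Hdown as [eps [Heps Hdown]]; pose proof (invS_step n) as Hst.
  exists (Rmin eps (/ INR (S n) - / INR (S (S n)))); split.
  - apply Rmin_pos; lra.
  - intros k Hk; destruct (Nat.lt_trichotomy k n) as [H | [H | H]]; [|exact H|].
    + pose proof (Hdown k H).
      pose proof (Rmin_l eps (/ INR (S n) - / INR (S (S n)))); lra.
    + pose proof (Hup k H).
      pose proof (Rmin_r eps (/ INR (S n) - / INR (S (S n)))); lra.
Qed.

(** The open witness collects the reals having a ball whose trace on the range of [f] stays in [U];
    halving the radius shows it open. *)
Lemma induced_R_open {A : Type} (f : A -> R) (U : A -> Prop) :
  (forall a, U a -> exists eps, 0 < eps /\
     forall b, Rabs (f a - f b) < eps -> U b) ->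
  induced_open R_open f U.
Proof.
  intro H.
  exists (fun x => exists eps, 0 < eps /\
    forall b, Rabs (x - f b) < eps -> U b); split.
  - intros x [eps [Heps Hx]]; exists (eps / 2); split; [lra|].
    intros y Hy; exists (eps / 2); split; [lra|].
    intros b Hb; apply Hx.
    replace (x - f b) with ((x - y) + (y - f b)) by ring.
    pose proof (Rabs_triang (x - y) (y - f b)); lra.
  - intro a; split; [apply H|].
    intros [eps [Heps Ha]]; apply Ha; rewrite Rminus_diag, Rabs_R0; exact Heps.
Qed.

Lemma ball_open (c r : R) : R_open (fun x => Rabs (c - x) < r).
Proof.
  intros x Hx; exists (r - Rabs (c - x)); split; [lra|].
  intros y Hy; replace (c - y) with ((c - x) + (x - y)) by ring.
  pose proof (Rabs_triang (c - x) (x - y)); lra.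
Qed.

Lemma induced_R2_open {A : Type} (f : A -> R * R) (U : A -> Prop) :
  (forall a, U a -> exists eps, 0 < eps /\
     forall b, Rabs (fst (f a) - fst (f b)) < eps ->
       Rabs (snd (f a) - snd (f b)) < eps -> U b) ->
  induced_open R2_open f U.
Proof.
  intro H.
  exists (fun x => exists eps, 0 < eps /\
    forall b, Rabs (fst x - fst (f b)) < eps ->
      Rabs (snd x - snd (f b)) < eps -> U b); split.
  - intros [x1 x2] [eps [Heps Hx]]; simpl in Hx.
    exists (fun y => Rabs (x1 - y) < eps / 2), (fun y => Rabs (x2 - y) < eps / 2).
    split; [apply ball_open|]; split; [apply ball_open|]; simpl.
    rewrite !Rminus_diag, Rabs_R0; split; [lra|]; split; [lra|].
    intros y1 y2 H1 H2; exists (eps / 2); split; [lra|].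
    intros b Hb1 Hb2; apply Hx.
    + replace (x1 - fst (f b)) with ((x1 - y1) + (y1 - fst (f b))) by ring.
      pose proof (Rabs_triang (x1 - y1) (y1 - fst (f b))); lra.
    + replace (x2 - snd (f b)) with ((x2 - y2) + (y2 - snd (f b))) by ring.
      pose proof (Rabs_triang (x2 - y2) (y2 - snd (f b))); lra.
  - intro a; split; [apply H|].
    intros [eps [Heps Ha]]; apply Ha; rewrite Rminus_diag, Rabs_R0; exact Heps.
Qed.

(** * Neighborhoods in K, S_0, V and W *)

(** Every point but x_0 is isolated. Since 1/(nm) <= 1/n, closeness to x_0 depends on n alone, which
    makes the threshold uniform in m. *)
Lemma K_open_iff (U : Kpt -> Prop) :
  K_open U <->
  (U None -> exists n0, forall n m, (n0 <= n)%nat -> U (Some (n, m))).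
Proof.
  split.
  - intros [U' [HU' HUU']] H0; apply HUU' in H0.
    destruct (HU' _ H0) as [O1 [O2 [HO1 [HO2 [H1 [H2 Hbox]]]]]].
    simpl in H1, H2.
    destruct (HO1 _ H1) as [e1 [He1 Hb1]], (HO2 _ H2) as [e2 [He2 Hb2]].
    destruct (invS_small _ He1) as [n1 Hn1], (invS_small _ He2) as [n2 Hn2].
    exists (n1 + n2)%nat; intros n m Hn; apply HUU', Hbox; cbn [kval fst snd].
    + apply Hb1; rewrite Rminus_0_l, Rabs_Ropp, Rabs_right;
        [apply Hn1; lia | left; apply invS_pos].
    + apply Hb2; rewrite Rminus_0_l, Rabs_Ropp, Rinv_mult.
      pose proof (invS_pos n); pose proof (invS_pos m).
      assert (Hm : / INR (S m) <= 1)
        by (rewrite <- Rinv_1; apply (invS_anti 0); lia).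
      rewrite Rabs_right by (apply Rle_ge, Rmult_le_pos; lra).
      specialize (Hn2 n ltac:(lia)); nra.
  - intro H; apply induced_R2_open; intros [[n m]|] HU.
    + destruct (invS_isolated n) as [e1 [He1 H1]].
      destruct (invS_isolated m) as [e2 [He2 H2]].
      pose proof (invS_pos n) as Hn.
      (* Once [n' = n], second coordinates differ by 1/(n+1) times the gap between 1/(m+1) and
         1/(m'+1), hence the scaling of [e2]. *)
      exists (Rmin e1 (/ INR (S n) * e2)); split; [apply Rmin_pos; nra|].
      pose proof (Rmin_l e1 (/ INR (S n) * e2)).
      pose proof (Rmin_r e1 (/ INR (S n) * e2)).
      intros [[n' m']|] Hb1 Hb2; cbn [kval fst snd] in Hb1, Hb2.
      * assert (n' = n) as -> by (apply H1; lra).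
        rewrite !Rinv_mult, <- Rmult_minus_distr_l, Rabs_mult in Hb2.
        rewrite (Rabs_right (/ INR (S n))) in Hb2 by lra.
        assert (m' = m) as ->; [|exact HU].
        apply H2, (Rmult_lt_reg_l (/ INR (S n))); lra.
      (* If 0 were within [e1] of 1/(n+1), so would be 1/(n+2), which lies between them. *)
      * exfalso; apply (Nat.neq_succ_diag_l n), H1.
        rewrite Rminus_0_r, Rabs_right in Hb1 by lra.
        pose proof (invS_step n); pose proof (invS_pos (S n)).
        rewrite Rabs_right; lra.
    + destruct (H HU) as [n0 Hn0].
      exists (/ INR (S n0)); split; [apply invS_pos|].
      intros [[n m]|] Hb1 _; [|exact HU]; apply Hn0.
      cbn [kval fst snd] in Hb1.
      rewrite Rminus_0_l, Rabs_Ropp, Rabs_right in Hb1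
        by (left; apply invS_pos).
      destruct (Nat.le_gt_cases n0 n) as [|Hlt]; [assumption|].
      pose proof (invS_anti n n0 ltac:(lia)); lra.
Qed.

Lemma S0_open_iff (U : S0pt -> Prop) :
  S0_open U <->
  (U None -> exists n0, forall n, (n0 <= n)%nat -> U (Some n)).
Proof.
  split.
  - intros [U' [HU' HUU']] H0; apply HUU' in H0.
    destruct (HU' _ H0) as [eps [Heps Hb]].
    destruct (invS_small _ Heps) as [n0 Hn0]; exists n0; intros n Hn.
    apply HUU', Hb; cbn [s0val].
    rewrite Rminus_0_l, Rabs_Ropp, Rabs_right;
      [apply Hn0; lia | left; apply invS_pos].
  - intro H; apply induced_R_open; intros [n|] HU.
    + destruct (invS_isolated n) as [eps [Heps Hn]].
      exists eps; split; [exact Heps|].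
      intros [k|] Hb; cbn [s0val] in Hb.
      * apply Hn in Hb; subst k; exact HU.
      * exfalso; apply (Nat.neq_succ_diag_l n), Hn.
        pose proof (invS_pos n).
        rewrite Rminus_0_r, Rabs_right in Hb by lra.
        pose proof (invS_step n); pose proof (invS_pos (S n)).
        rewrite Rabs_right; lra.
    + destruct (H HU) as [n0 Hn0].
      exists (/ INR (S n0)); split; [apply invS_pos|].
      intros [n|] Hb; [|exact HU]; apply Hn0.
      cbn [s0val] in Hb.
      rewrite Rminus_0_l, Rabs_Ropp, Rabs_right in Hb
        by (left; apply invS_pos).
      destruct (Nat.le_gt_cases n0 n) as [|Hlt]; [assumption|].
      pose proof (invS_anti n n0 ltac:(lia)); lra.
Qed.

(** The factor N is discrete, so each spine [p] has its own threshold, with no uniformity in [p]. *)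
Lemma V_open_iff (U : Vpt -> Prop) :
  V_open U <->
  (U None -> forall p, exists r0, forall r, (r0 <= r)%nat -> U (Some (p, r))).
Proof.
  split.
  - intros HU H0 p.
    destruct (HU (p, None) H0) as [O1 [O2 [_ [HO2 [H1 [H2 Hbox]]]]]].
    destruct (proj1 (S0_open_iff O2) HO2 H2) as [r0 Hr0].
    exists r0; intros r Hr; apply (Hbox p (Some r)); auto.
  - intros H [p s] Hps.
    exists (fun p' => p' = p), (fun s' => U (qV (p, s'))).
    split; [exact I|]; split.
    + apply S0_open_iff; intro H0; exact (H H0 p).
    + repeat split; [exact Hps|]; intros p' s' -> Hs'; exact Hs'.
Qed.

(** The shift n+q in the index of y_{p,n+q} is decisive: a large n alone passes the threshold on
    spine [p], whatever q is. *)
Lemma W_open_z0 (U : Wpt -> Prop) (p : nat) : W_open U -> U z0 ->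
  exists n0, forall n m, (n0 <= n)%nat ->
    U (z2 n m) /\ forall q, U (z4 n m p q).
Proof.
  intros HU H0; destruct (HU (S p)) as [O [HO HUO]].
  apply (HUO z0 I) in H0.
  destruct (HO _ H0) as [O1 [O2 [HO1 [HO2 [H1 [H2 Hbox]]]]]].
  simpl in H1, H2.
  destruct (proj1 (K_open_iff O1) HO1 H1) as [n1 Hn1].
  destruct (proj1 (V_open_iff O2) HO2 H2 p) as [r0 Hr0].
  exists (n1 + r0)%nat; intros n m Hn; split; [|intro q]; apply HUO; simpl.
  - exact I.
  - apply Hbox; [apply Hn1; lia | exact H2].
  - lia.
  - apply Hbox; [apply Hn1 | apply Hr0]; lia.
Qed.

Lemma W_open_z2 (U : Wpt -> Prop) (n m p : nat) : W_open U -> U (z2 n m) ->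
  exists q0, forall q, (q0 <= q)%nat -> U (z4 n m p q).
Proof.
  intros HU H0; destruct (HU (S p)) as [O [HO HUO]].
  apply (HUO (z2 n m) I) in H0.
  destruct (HO _ H0) as [O1 [O2 [HO1 [HO2 [H1 [H2 Hbox]]]]]].
  simpl in H1, H2.
  destruct (proj1 (V_open_iff O2) HO2 H2 p) as [r0 Hr0].
  exists r0; intros q Hq; apply HUO; simpl; [lia|].
  apply Hbox; [exact H1 | apply Hr0; lia].
Qed.

Lemma W_open_avoid (N : nat -> nat) (q : nat -> nat -> nat -> nat) :
  W_open (fun z => match z with
    | z4 n m p r => ~ ((n <= N p)%nat /\ r = q p n m)
    | _ => True
    end).
Proof.
  intro P.
  (* The guard [p < P] restricts the removal to points of W_P, so that finitely many values of [N]
     matter. *)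
  exists (fun kv => match kv with
    | (Some (n, m), Some (p, r)) =>
        (p < P)%nat -> ~ ((n <= N p)%nat /\ r = (n + q p n m + 1)%nat)
    | _ => True
    end); split.
  - intros [[[n m]|] v] Hv.
    + exists (fun k => k = Some (n, m)).
      exists (fun v => match v with
        (* With n and m fixed, at most one point is removed from each spine. *)
        | Some (p, r) =>
            (p < P)%nat -> ~ ((n <= N p)%nat /\ r = (n + q p n m + 1)%nat)
        | _ => True
        end).
      split; [apply K_open_iff; discriminate|]; split.
      * apply V_open_iff; intros _ p; exists (n + q p n m + 2)%nat; lia.
      * split; [reflexivity|]; split; [exact Hv|]; intros k v' -> Hv'; exact Hv'.
    (* Near x_0 the condition n > b excludes all removed points at once. *)
    + destruct (finite_upper_bound N P) as [b Hb].
      exists (fun k => match k with Some (n, _) => (b < n)%nat | None => True end).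
      exists (fun _ => True).
      split; [apply K_open_iff; intros _; exists (S b); intros; lia|].
      split; [apply V_open_iff; intros _ p; exists 0%nat; auto|].
      split; [exact I|]; split; [exact I|].
      intros [[n m]|] [[p r]|] Hk _; try exact I.
      intros Hp [Hn _]; specialize (Hb p); lia.
  - intros [|n m|n m p r] Hz; simpl in *; try tauto.
    assert (Heq : (n + r + 1 = n + q p n m + 1 <-> r = q p n m)%nat) by lia.
    rewrite Heq; tauto.
Qed.

(** * A metric fan and diagonalization under property (M) *)

(** Path length between leg ends of a star, [w a] being the length of leg [a]; the point of weight 0
    is the center. *)
Definition spider_dist {A : Type} (w : A -> R) (a b : A) : R :=
  if excluded_middle_informative (a = b) then 0 else w a + w b.

Lemma spider_dist_metric {A : Type} (w : A -> R) (a0 : A) :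
  w a0 = 0 -> (forall a, a <> a0 -> 0 < w a) -> is_metric (spider_dist w).
Proof.
  intros Hw0 Hw.
  assert (Hnn : forall a, 0 <= w a).
  { intro a; destruct (classic (a = a0)) as [-> | Ha]; [lra|].
    left; apply Hw, Ha. }
  unfold spider_dist; split; [|split; [|split]].
  - intros a b; pose proof (Hnn a); pose proof (Hnn b).
    destruct excluded_middle_informative; lra.
  - intros a b; destruct excluded_middle_informative as [|Hab]; [tauto|].
    split; [|tauto]; intro Hz; exfalso; apply Hab.
    assert (forall c, w c = 0 -> c = a0) as Hz0.
    { intros c Hc; apply NNPP; intro Hne; specialize (Hw c Hne); lra. }
    pose proof (Hnn a); pose proof (Hnn b).
    rewrite (Hz0 a), (Hz0 b) by lra; reflexivity.
  - intros a b; do 2 destruct excluded_middle_informative; try congruence; lra.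
  - intros a b c; pose proof (Hnn a); pose proof (Hnn b); pose proof (Hnn c).
    do 3 destruct excluded_middle_informative; subst; try congruence; lra.
Qed.

(** Property (M) only gives a base in the image of some neighborhood of the center, so the sets
    [B i], open in [X], control only the points with [n0 <= n]. *)
Lemma propM_base (X : Type) (oX : (X -> Prop) -> Prop) (x : X)
  (s : nat -> nat -> nat -> X) :
  propM X oX ->
  (forall O, oX O -> O x ->
     exists n0, forall n m q, (n0 <= n)%nat -> O (s n m q)) ->
  exists n0 (B : nat -> X -> Prop),
    (forall i, oX (B i) /\ B i x) /\
    forall O, oX O -> O x -> exists i, forall n m q, (n0 <= n)%nat ->
      B i (s n m q) -> O (s n m q).
Proof.
  intros HM Hs.
  set (w := fun y : option (nat * nat * nat) =>
    match y with None => 0 | Some (n, _, _) => / INR (S n) end).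
  set (f := fun y : option (nat * nat * nat) =>
    match y with None => x | Some (n, m, q) => s n m q end).
  assert (Hw : forall y, y <> None -> 0 < w y).
  { intros [[[n m] q]|] Hy; [apply invS_pos | congruence]. }
  assert (Hmet : metrizable _ (metric_open (spider_dist w))).
  { exists (spider_dist w); split; [|tauto].
    exact (spider_dist_metric w None eq_refl Hw). }
  assert (Hcont : continuous (metric_open (spider_dist w)) oX f).
  { intros O HO [[[n m] q]|] Hy.
    - exists (/ INR (S n)); split; [apply invS_pos|].
      intros z Hz; unfold spider_dist in Hz.
      destruct excluded_middle_informative as [<- | Hne]; [exact Hy|].
      exfalso; assert (0 <= w z).
      { destruct z; [left; apply Hw; discriminate | simpl; lra]. }
      (* Any other point is at distance at least 1/(n+1): leg ends are isolated. *)
      cbn [w] in Hz; lra.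
    - destruct (Hs O HO Hy) as [n0 Hn0].
      exists (/ INR (S n0)); split; [apply invS_pos|].
      intros [[[n m] q]|] Hz; [|exact Hy]; apply Hn0.
      unfold spider_dist in Hz.
      destruct excluded_middle_informative as [He | _]; [discriminate|].
      cbn [w] in Hz.
      destruct (Nat.le_gt_cases n0 n) as [|Hlt]; [assumption|].
      pose proof (invS_anti n n0 ltac:(lia)); lra. }
  destruct (HM _ _ Hmet f Hcont None) as [U [HU [H0 [B [HB Hbase]]]]].
  assert (HUn : exists n0, forall n m q, (n0 <= n)%nat -> U (Some (n, m, q))).
  { destruct HU as [O [HO [HO0 HOU]]].
    destruct (HO None HO0) as [eps [Heps Hball]].
    destruct (invS_small eps Heps) as [n0 Hn0].
    exists n0; intros n m q Hn; apply HOU, Hball; unfold spider_dist.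
    destruct excluded_middle_informative as [He | _]; [discriminate|].
    cbn [w]; specialize (Hn0 n Hn); lra. }
  destruct HUn as [n0 Hn0].
  (* Each relative neighborhood is replaced by an open set of [X] whose trace lies in it. *)
  assert (HB' : forall i, exists O, (oX O /\ O x) /\
    forall z : {x | image f U x}, O (proj1_sig z) -> B i z).
  { intro i; destruct (HB i) as [O [[O' [HO' HOO']] [HO0 HOB]]].
    exists O'; split; [split; [exact HO'|]|].
    - apply (HOO' _) in HO0; exact HO0.
    - intros z Hz; apply HOB, HOO', Hz. }
  destruct (functional_choice _ HB') as [B' HB'spec].
  exists n0, B'; split; [intro i; apply HB'spec|].
  intros O HO HOx.
  destruct (Hbase (fun z => O (proj1_sig z))) as [i Hi].
  - exists O; split; [exact HO | tauto].
  - exact HOx.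
  - exists i; intros n m q Hn Hb.
    assert (Him : image f U (s n m q)).
    { exists (Some (n, m, q)); split; [apply Hn0, Hn | reflexivity]. }
    apply (Hi (exist _ _ Him)), HB'spec, Hb.
Qed.

(** [Q n m] is chosen so that later [q] put [s n m q] in all of [B 0], ..., [B m]. Asking only for
    an eventual lower bound on [q] lets one sequence serve many coordinates. *)
Lemma propM_diagonal (X : Type) (oX : (X -> Prop) -> Prop) (x : X)
  (s : nat -> nat -> nat -> X) :
  propM X oX ->
  (forall O, oX O -> O x ->
     exists n0, forall n m q, (n0 <= n)%nat -> O (s n m q)) ->
  (forall n m O, oX O -> O x ->
     exists q0, forall q, (q0 <= q)%nat -> O (s n m q)) ->
  exists n0 (Q : nat -> nat -> nat), forall n (q : nat -> nat) m0,
    (n0 <= n)%nat -> (forall m, (m0 <= m)%nat -> (Q n m <= q m)%nat) ->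
    forall O, oX O -> O x ->
      exists m1, forall m, (m1 <= m)%nat -> O (s n m (q m)).
Proof.
  intros HM Hn Hq.
  destruct (propM_base X oX x s HM Hn) as [n0 [B [HB Hbase]]].
  assert (HQ : forall nm : nat * nat, exists q0, forall i q,
    (i <= snd nm)%nat -> (q0 <= q)%nat -> B i (s (fst nm) (snd nm) q)).
  { intros [n m]; apply uniform_threshold.
    intro i; destruct (HB i); apply Hq; assumption. }
  destruct (functional_choice _ HQ) as [Q HQspec].
  exists n0, (fun n m => Q (n, m)); intros n q m0 Hn0 HQq O HO HOx.
  destruct (Hbase O HO HOx) as [i Hi].
  exists (m0 + i)%nat; intros m Hm; apply Hi; [exact Hn0|].
  apply (HQspec (n, m)); simpl; [lia | apply HQq; lia].
Qed.

(** * Groups, subspaces and products *)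

Lemma group_mul_inv {G : Type} (mul : G -> G -> G) (inv : G -> G) (e : G) :
  (forall x y z, mul x (mul y z) = mul (mul x y) z) ->
  (forall x, mul e x = x) -> (forall x, mul (inv x) x = e) ->
  forall x, mul x (inv x) = e.
Proof.
  intros HA HE HI x.
  rewrite <- (HE (mul x (inv x))), <- (HI (inv x)) at 1.
  rewrite <- HA, (HA (inv x)), HI, HE; apply HI.
Qed.

Lemma subspace_embedding {X : Type} (oX : (X -> Prop) -> Prop) (A : X -> Prop)
  {Y : Type} (oY : (Y -> Prop) -> Prop) (g : Y -> {x | A x}) (f : {x | A x} -> Y) :
  (forall y, f (g y) = y) -> continuous (subspace_open oX A) oY f ->
  forall V, oY V -> exists U, oX U /\ forall y, V y <-> U (proj1_sig (g y)).
Proof.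
  intros Hfg Hf V HV; destruct (Hf V HV) as [U [HU HUV]].
  exists U; split; [exact HU|]; intro y; rewrite <- (HUV (g y)), Hfg; tauto.
Qed.

Lemma subspace_continuous {X : Type} (oX : (X -> Prop) -> Prop) (A : X -> Prop)
  {Y : Type} (oY : (Y -> Prop) -> Prop) (g : Y -> {x | A x}) :
  continuous oY (subspace_open oX A) g ->
  continuous oY oX (fun y => proj1_sig (g y)).
Proof.
  intros Hg U HU; apply (Hg (fun s => U (proj1_sig s))).
  exists U; split; [exact HU | tauto].
Qed.

Lemma prod_proj_continuous (X : nat -> Type)
  (oX : forall n, (X n -> Prop) -> Prop) (j : nat) :
  (forall n, is_topology (oX n)) ->
  continuous (prod_open X oX) (oX j) (fun x => x j).
Proof.
  intros HT O HO x Hx.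
  (* The cylinder over [O]. Coordinates have different types, so [O] is transported along [j = n];
     at [j] itself uniqueness of identity proofs removes the transport. *)
  pose (C := fun n => match Nat.eq_dec j n with
    | left E => eq_rect j (fun k => X k -> Prop) O n E
    | right _ => fun _ => True
    end).
  assert (HC : C j = O).
  { unfold C; destruct (Nat.eq_dec j j) as [E|]; [|congruence].
    rewrite (Eqdep_dec.UIP_refl_nat j E); reflexivity. }
  exists (S j), C; repeat split.
  - intro n; unfold C; destruct (Nat.eq_dec j n) as [<-|]; [exact HO|].
    apply (HT n).
  - intros n Hn t; unfold C; destruct (Nat.eq_dec j n); [lia | exact I].
  - intro n; unfold C; destruct (Nat.eq_dec j n) as [<-|]; [exact Hx | exact I].
  - intros y Hy; rewrite <- HC; apply Hy.
Qed.

(** * A topological group containing a copy of W *)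

Section CopyOfW.

Variables (G : Type) (oG : (G -> Prop) -> Prop).
Variables (mul : G -> G -> G) (inv : G -> G) (e : G).
Hypothesis HG : is_topological_group G oG mul inv e.
Variable w : Wpt -> G.
Hypothesis w_continuous : continuous W_open oG w.

Definition fan_point (p n m q : nat) : G :=
  mul (inv (w (z2 n m))) (w (z4 n m p q)).

(** Continuity of the map sending (a, b) to a^-1 b at a diagonal point, where its value is [e]. Both
    convergence statements follow, at z_0 and at z_{n,m}. *)
Lemma fan_nbhd (O : G -> Prop) (z : Wpt) : oG O -> O e ->
  exists U, W_open U /\ U z /\ forall a b, U a -> U b -> O (mul (inv (w a)) (w b)).
Proof.
  destruct HG as [HT [HA [HE [HI [Hmul Hinv]]]]]; intros HO HOe.
  destruct (Hmul O HO (inv (w z), w z)) as [O1 [O2 [HO1 [HO2 [H1 [H2 Hbox]]]]]].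
  { simpl; rewrite HI; exact HOe. }
  exists (fun a => O1 (inv (w a)) /\ O2 (w a)); split; [|split].
  - apply (w_continuous (fun g => O1 (inv g) /\ O2 g)).
    apply HT; [apply (Hinv O1 HO1) | exact HO2].
  - split; assumption.
  - intros a b [Ha _] [_ Hb]; exact (Hbox _ _ Ha Hb).
Qed.

Lemma fan_point_cvg_n (p : nat) (O : G -> Prop) : oG O -> O e ->
  exists n0, forall n m q, (n0 <= n)%nat -> O (fan_point p n m q).
Proof.
  intros HO HOe; destruct (fan_nbhd O z0 HO HOe) as [U [HU [H0 HUO]]].
  destruct (W_open_z0 U p HU H0) as [n0 Hn0].
  exists n0; intros n m q Hn; destruct (Hn0 n m Hn); apply HUO; auto.
Qed.

Lemma fan_point_cvg_q (p n m : nat) (O : G -> Prop) : oG O -> O e ->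
  exists q0, forall q, (q0 <= q)%nat -> O (fan_point p n m q).
Proof.
  intros HO HOe; destruct (fan_nbhd O (z2 n m) HO HOe) as [U [HU [H0 HUO]]].
  destruct (W_open_z2 U n m p HU H0) as [q0 Hq0].
  exists q0; intros q Hq; apply HUO; auto.
Qed.

Lemma mul_fan_point (p n m q : nat) :
  mul (w (z2 n m)) (fan_point p n m q) = w (z4 n m p q).
Proof.
  destruct HG as [_ [HA [HE [HI _]]]]; unfold fan_point.
  rewrite HA, (group_mul_inv mul inv e HA HE HI), HE; reflexivity.
Qed.

Lemma fan_escape (N : nat -> nat) (q : nat -> nat -> nat -> nat) :
  (forall V, W_open V -> exists U, oG U /\ forall z, V z <-> U (w z)) ->
  exists O n0, oG O /\ O e /\ forall p n m, (n0 <= n <= N p)%nat ->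
    ~ O (fan_point p n m (q p n m)).
Proof.
  intro w_embedding; destruct HG as [_ [HA [HE [HI [Hmul _]]]]].
  destruct (w_embedding _ (W_open_avoid N q)) as [D [HD HDw]].
  destruct (Hmul D HD (w z0, e)) as [O1 [O2 [HO1 [HO2 [H1 [H2 Hbox]]]]]].
  { simpl; replace (mul (w z0) e) with (w z0).
    - apply HDw; exact I.
    - rewrite <- (HI (w z0)), HA, (group_mul_inv mul inv e HA HE HI), HE.
      reflexivity. }
  (* The spine 0 is arbitrary: only the points z_{n,m} are used, so [n0] does not depend on [p]. *)
  destruct (W_open_z0 _ 0 (w_continuous O1 HO1) H1) as [n0 Hn0].
  exists O2, n0; split; [exact HO2|]; split; [exact H2|].
  intros p n m Hn HO; destruct (Hn0 n m ltac:(lia)) as [Hz _].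
  specialize (Hbox _ _ Hz HO); simpl in Hbox; rewrite mul_fan_point in Hbox.
  apply HDw in Hbox; apply Hbox; lia.
Qed.

End CopyOfW.

Theorem theorem3 (G : Type) (oG : (G -> Prop) -> Prop)
  (mul : G -> G -> G) (inv : G -> G) (e : G) :
  is_topological_group G oG mul inv e ->
  (exists A : G -> Prop, homeomorphic {x : G | A x} (subspace_open oG A) Wpt W_open) ->
  ~ (exists (X : nat -> Type) (oX : forall n, (X n -> Prop) -> Prop),
       (forall n, is_topology (oX n)) /\
       (forall n, propM (X n) (oX n)) /\
       exists B : (forall n, X n) -> Prop,
         homeomorphic G oG {x : forall n, X n | B x} (subspace_open (prod_open X oX) B)).
Proof.
  intros HG [A [fW [gW [_ [HfgW [HfW HgW]]]]]]
    [X [oX [HT [HM [B [phi [psi [Hpsi [_ [Hphi_c Hpsi_c]]]]]]]]]].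
  set (w := fun z => proj1_sig (gW z)).
  assert (Hw : continuous W_open oG w) by (apply subspace_continuous, HgW).
  pose proof (subspace_embedding _ _ _ gW fW HfgW HfW) as Hemb.
  set (pr := fun j g => proj1_sig (phi g) j).
  assert (Hpr : forall j, continuous oG (oX j) (pr j)).
  { intros j O HO; apply (subspace_continuous _ _ _ _ Hphi_c (fun x => O (x j))).
    exact (prod_proj_continuous X oX j HT O HO). }
  set (s := fan_point G mul inv w).
  assert (Hdiag : forall jp : nat * nat, exists NQ : nat * (nat -> nat -> nat),
    forall n (q : nat -> nat) m0, (fst NQ <= n)%nat ->
      (forall m, (m0 <= m)%nat -> (snd NQ n m <= q m)%nat) ->
      forall O, oX (fst jp) O -> O (pr (fst jp) e) ->
        exists m1, forall m, (m1 <= m)%nat ->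
          O (pr (fst jp) (s (snd jp) n m (q m)))).
  { intros [j p].
    destruct (propM_diagonal (X j) (oX j) (pr j e)
      (fun n m q => pr j (s p n m q)) (HM j)) as [n0 [Q HQ]].
    - intros O HO HOe.
      exact (fan_point_cvg_n _ _ _ _ _ HG w Hw p _ (Hpr j O HO) HOe).
    - intros n m O HO HOe.
      exact (fan_point_cvg_q _ _ _ _ _ HG w Hw p n m _ (Hpr j O HO) HOe).
    - exists (n0, Q); exact HQ. }
  destruct (functional_choice _ Hdiag) as [NQ HNQ]; clear Hdiag.
  (* The summand [p] forces [N p >= p], so that [N p] eventually exceeds any given [n0]. *)
  destruct (functional_choice
    (fun p b => forall j, (j <= p)%nat -> (p + fst (NQ (j, p)) <= b)%nat))
    as [N HN].
  { intro p; apply (finite_upper_bound (fun j => (p + fst (NQ (j, p)))%nat)). }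
  (* Infinitely many coordinates cannot be dominated at a single m; bounding those with [j <= m]
     dominates each of them from [m = j] on. *)
  destruct (functional_choice
    (fun (pnm : nat * nat * nat) b => forall j, (j <= snd pnm)%nat ->
       (snd (NQ (j, fst (fst pnm))) (snd (fst pnm)) (snd pnm) <= b)%nat))
    as [q Hq].
  { intros [[p n] m].
    apply (finite_upper_bound (fun j => snd (NQ (j, p)) n m)). }
  destruct (fan_escape _ _ _ _ _ HG w Hw N (fun p n m => q (p, n, m)) Hemb)
    as [O [n0 [HO [HOe Hesc]]]].
  destruct (subspace_embedding _ _ _ phi psi Hpsi Hpsi_c O HO) as [U [HU HUO]].
  destruct (HU _ (proj1 (HUO e) HOe)) as [k [C [HC [HCk [HCe HCU]]]]].
  (* [p >= k] makes [N p] pass the thresholds of all constrained coordinates [j < k]; [p >= n0]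
     gives [N p >= n0]. *)
  set (p := (k + n0)%nat).
  assert (Hev : forall j, exists m1, forall m, (m1 <= m)%nat ->
    C j (pr j (s p (N p) m (q (p, N p, m))))).
  { intro j; destruct (Nat.le_gt_cases k j) as [Hkj | Hjk].
    - exists 0%nat; intros; apply HCk, Hkj.
    - apply (HNQ (j, p) (N p) (fun m => q (p, N p, m)) j); simpl.
      + specialize (HN p j ltac:(lia)); lia.
      + intros m Hm; exact (Hq (p, N p, m) j Hm).
      + apply HC.
      + apply HCe. }
  (* One m serves the finitely many constrained coordinates, so the fan point enters [O]. *)
  destruct (uniform_threshold _ Hev k) as [m Hm].
  apply (Hesc p (N p) m).
  - specialize (HN p 0%nat ltac:(lia)); lia.
  - apply HUO, HCU; intro j; destruct (Nat.le_gt_cases k j) as [Hkj | Hjk].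
    + apply HCk, Hkj.
    + apply Hm; lia.
Qed.
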